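(* Let $m\ge 2$ be an integer and let $\sigma_0=\pm1$ if $m$ is odd and $\sigma_0=(-1)^{m/2}$ if $m$ is even. For a real $(m-1)\times(m-1)$ signed permutation matrix $P$ and $\tau>0$, consider the linear system $$D\,\partial_t q + A\,\partial_x q = B q,\qquad q(x,t)=(q_0,\dots,q_{m-1})^T\in\mathbb{C}^m,$$ with $$A=\begin{bmatrix} 0_{1\times(m-1)} & \sigma_0\\ P & 0_{(m-1)\times 1}\end{bmatrix},\quad B=\begin{bmatrix} 0 & 0_{1\times(m-1)}\\ 0_{(m-1)\times 1} & P\end{bmatrix},\quad D=\operatorname{diag}(1,\tau,\dots,\tau).$$ Call this system stable if for every $\tau>0$, every real wavenumber $k$, and every $\omega\in\mathbb{C}$ with $\det(-i\omega D + ikA - B)=0$, one has $\operatorname{Im}\omega\le 0$. Then the system is stable if and only if $P=P^*$, where $P^*=(p^*_{ij})_{i,j=1}^{m-1}$ is defined by $$p^*_{ij}=\begin{cases}0 & i+j\ne m,\\ \sigma_0(-1)^{j-1} & i+j=m,\ j\le m/2,\\ \sigma_0(-1)^{m-j} & i+j=m,\ j> m/2.\end{cases}$$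
   Context: A real signed permutation matrix is a square matrix with all entries in $\{-1,0,+1\}$ having exactly one nonzero entry in each row and in each column. The system is a first-order relaxation of the linear PDE $\partial_t u+\sigma_0\partial_x^m u=0$, with $q_j$ intended to approximate $\partial_x^j u$; written componentwise it reads $\partial_t q_0+\sigma_0\partial_x q_{m-1}=0$ and, for $i=1,\dots,m-1$, $\tau\partial_t q_i+\sum_{j=1}^{m-1}p_{ij}\partial_x q_{j-1}=\sum_{j=1}^{m-1}p_{ij}q_j$. The dispersion relation is obtained from the ansatz $q(x,t)=\hat q\,e^{i(kx-\omega t)}$. *)

(* Defs.v *)
From HB Require Import structures.
From mathcomp Require Import all_boot all_order all_algebra.
From mathcomp Require Import complex.
Set Implicit Arguments. Unset Strict Implicit. Unset Printing Implicit Defensive.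
Import Order.TTheory GRing.Theory Num.Theory.
Local Open Scope ring_scope.

Definition signed_perm_mx (R : numDomainType) (n : nat) (P : 'M[R]_n) : Prop :=
  (forall i j, P i j \in [:: -1; 0; 1]) /\
  (forall i, #|[pred j | P i j != 0]| = 1%N) /\
  (forall j, #|[pred i | P i j != 0]| = 1%N).

Definition sigma0_ok (R : numDomainType) (m : nat) (s : R) : Prop :=
  (odd m -> s = 1 \/ s = -1) /\ (~~ odd m -> s = (-1) ^+ m./2).

(* The integer m >= 2 is written m = n.+2, so that P is (m-1)x(m-1) = 'M_n.+1
   and the system matrices are m x m. *)
Definition sysA (R : pzRingType) (n : nat) (s : R) (P : 'M[R]_n.+1)
  : 'M[R]_(n.+2) :=
  castmx (erefl (n.+2), addn1 n.+1)
    (block_mx (0 : 'M_(1, n.+1)) (s%:M : 'M_1) P (0 : 'M_(n.+1, 1))).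

Definition sysB (R : pzRingType) (n : nat) (P : 'M[R]_n.+1) : 'M[R]_(n.+2) :=
  block_mx (0 : 'M_1) 0 0 P.

Definition sysD (R : pzRingType) (n : nat) (tau : R) : 'M[R]_(n.+2) :=
  block_mx (1%:M : 'M_1) 0 0 (tau%:M : 'M_n.+1).

Definition stable (R : rcfType) (n : nat) (s : R) (P : 'M[R]_n.+1) : Prop :=
  forall (tau : R), 0 < tau -> forall (k : R) (omega : R[i]),
    \det (- ('i%C * omega) *: map_mx (real_complex R) (sysD n tau)
          + ('i%C * (real_complex R k)) *: map_mx (real_complex R) (sysA s P)
          - map_mx (real_complex R) (sysB P)) = 0 ->
    complex.Im omega <= 0.

(* The matrix P^* (size m-1 with m = n.+2), 1-based indices i1 = i+1, j1 = j+1: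
   p*_{i1 j1} = 0 if i1+j1 <> m; s(-1)^(j1-1) if i1+j1 = m and j1 <= m/2;
   s(-1)^(m-j1) if i1+j1 = m and j1 > m/2. *)
Definition Pstar (R : pzRingType) (n : nat) (s : R) : 'M[R]_n.+1 :=
  \matrix_(i < n.+1, j < n.+1)
    if (i.+1 + j.+1 == n.+2)%N then
      (if (2 * j.+1 <= n.+2)%N then s * (-1) ^+ (j.+1 - 1)
       else s * (-1) ^+ (n.+2 - j.+1))
    else 0.

(* Main.v *)
Require Import Defs.
From HB Require Import structures.
From mathcomp Require Import all_boot all_order all_algebra.
From mathcomp Require Import complex spectral ring lra zify.
Import Order.TTheory GRing.Theory Num.Theory.
Local Open Scope ring_scope.
Local Open Scope sesquilinear_scope.

(** Take tau = 1 and write lambda = -i omega, so that stability means that the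
    spectrum of B - ikA lies in Re <= 0 for every real k.  At k = 0 this bounds
    the spectrum of P; as k -> +-oo the rescaled spectrum tends to that of -iA,
    so A must have real spectrum.  Both P and A are real orthogonal, hence
    normal, so by the spectral theorem P + P^T <= 0 and A = A^T.  For a signed
    permutation matrix P the first condition means that P is antisymmetric off
    the diagonal; together with the symmetry of A it determines P entry by
    entry along the antidiagonal.  Conversely, these two symmetries give an
    energy estimate for P^*. *)

(** * Eigenvalues and the spectral theorem for normal matrices *)

Lemma eigenvalueE (F : fieldType) (n : nat) (M : 'M[F]_n) (a : F) :
  eigenvalue M a = (\det (a%:M - M) == 0).
Proof.
rewrite /eigenvalue kermx_eq0 row_free_unit unitmxE unitfE negbK.
by rewrite -opprB -scaleN1r detZ mulf_eq0 signr_eq0.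
Qed.

Lemma eigenvalueZ (F : fieldType) (n : nat) (M : 'M[F]_n) (a c : F) :
  eigenvalue M a -> eigenvalue (c *: M) (c * a).
Proof.
move=> /eigenvalueP[v vM v0]; apply/eigenvalueP; exists v => //.
by rewrite -scalemxAr vM scalerA.
Qed.

(** The rows of the unitary factor are left eigenvectors, so hypotheses on the spectrum of [M] pass
    to every entry of [d]. *)
Lemma normalmx_diagonalize (C : numClosedFieldType) (n : nat) (M : 'M[C]_n) :
  M \is normalmx ->
  exists U : 'M[C]_n, exists d : 'rV[C]_n,
    M = U^t* *m diag_mx d *m U /\ forall i, eigenvalue M (d 0 i).
Proof.
move=> /orthomx_spectralP EM; have Uu := spectral_unitarymx M.
rewrite (invmx_unitary Uu) in EM.
move: EM Uu; move: (spectralmx M) (spectral_diag M) => U d EM Uu.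
exists U, d; split=> // i; apply/eigenvalueP.
have UM : U *m M = diag_mx d *m U.
  by rewrite EM !mulmxA (unitarymxP Uu) mul1mx.
exists (row i U).
  by rewrite -row_mul UM row_mul row_diag_mx -scalemxAl -rowE.
apply/eqP => Ui0; have /(congr1 (mulmx^~ (U^t*))) := Ui0.
rewrite mul0mx -row_mul (unitarymxP Uu) => /rowP/(_ i)/eqP.
by rewrite !mxE eqxx oner_eq0.
Qed.

Lemma normalmx_real_spectrum (C : numClosedFieldType) (n : nat) (M : 'M[C]_n) :
  M \is normalmx -> (forall a, eigenvalue M a -> a^* = a) -> M^t* = M.
Proof.
move=> /normalmx_diagonalize[U [d [EM ev]]] reald.
rewrite {1}EM !trmx_mul !map_mxM trmxCK mulmxA tr_diag_mx map_diag_mx.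
suff -> : map_mx Num.conj d = d by rewrite -EM.
by apply/rowP => i; rewrite mxE reald.
Qed.

(** The unitary basis that diagonalizes [M] also diagonalizes [M + M^t*], so the form is a sum of
    |y_i|^2 with nonpositive weights d_i + conj d_i. *)
Lemma normalmx_dissipative (C : numClosedFieldType) (n : nat) (M : 'M[C]_n) :
  M \is normalmx -> (forall a, eigenvalue M a -> a + a^* <= 0) ->
  forall x : 'rV[C]_n, (x *m (M + M^t*) *m x^t*) 0 0 <= 0.
Proof.
move=> /normalmx_diagonalize[U [d [EM ev]]] dneg x.
have -> : M + M^t* = U^t* *m diag_mx (d + map_mx Num.conj d) *m U.
  rewrite {2}EM !trmx_mul !map_mxM trmxCK mulmxA tr_diag_mx map_diag_mx.
  by rewrite {1}EM -mulmxDl -mulmxDr (linearD (@diag_mx C n)).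
rewrite !mulmxA -mulmxA; set y := x *m U^t*.
have -> : U *m x^t* = y^t* by rewrite /y trmx_mul map_mxM trmxCK.
rewrite mxE sumr_le0// => i _.
rewrite mul_mx_diag !mxE mulrAC -normCK mulr_ge0_le0 ?exprn_ge0 //.
exact/dneg/ev.
Qed.

(** * The sign sigma_0 and the entries of the system matrices *)

Lemma sigma0_sqr (R : numDomainType) (m : nat) (s : R) :
  sigma0_ok m s -> s * s = 1.
Proof.
move=> [sodd seven]; case: (boolP (odd m)) => [/sodd[]|/seven] ->.
- by rewrite mulr1.
- by rewrite mulrNN mulr1.
by rewrite -expr2 sqrr_sign.
Qed.

Lemma ord0_or_lift (n : nat) (i : 'I_n.+2) :
  i = 0 \/ exists i' : 'I_n.+1, i = lift 0 i'.
Proof. by case: (unliftP 0 i) => [i'|]; [right; exists i'|left]. Qed.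

Section Entries.
Variables (R : pzRingType) (n : nat) (s : R) (P : 'M[R]_n.+1).

Lemma sysA0E (j : 'I_n.+2) : sysA s P 0 j = if j == ord_max then s else 0.
Proof.
rewrite /sysA castmxE cast_ord_id; set j' := cast_ord _ j.
have -> : (0 : 'I_(1 + n.+1)) = lshift n.+1 (0 : 'I_1) by apply: val_inj.
rewrite -val_eqE /=; case: (splitP j') => k /= jk.
  have -> : j' = lshift 1 k by apply: val_inj.
  by rewrite (@block_mxEul _ 1 n.+1 n.+1 1) mxE jk ltn_eqF.
have -> : j' = rshift n.+1 k by apply: val_inj.
by rewrite (@block_mxEur _ 1 n.+1 n.+1 1) !mxE jk (ord1 k) addn0 !eqxx mulr1n.
Qed.

(** The guard keeps [inord] away from its default value in the last column. *)
Lemma sysASE (i : 'I_n.+1) (j : 'I_n.+2) :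
  sysA s P (lift 0 i) j = if (j < n.+1)%N then P i (inord j) else 0.
Proof.
rewrite /sysA castmxE cast_ord_id; set j' := cast_ord _ j.
have -> : (lift 0 i : 'I_(1 + n.+1)) = rshift 1 i by apply: val_inj.
case: (splitP j') => k /= jk.
  have -> : j' = lshift 1 k by apply: val_inj.
  by rewrite (@block_mxEdl _ 1 n.+1 n.+1 1) jk inord_val.
have -> : j' = rshift n.+1 k by apply: val_inj.
by rewrite (@block_mxEdr _ 1 n.+1 n.+1 1) mxE.
Qed.

Lemma sysBE (i j : 'I_n.+2) :
  sysB P i j = if unlift 0 i is Some i' then
                 if unlift 0 j is Some j' then P i' j' else 0
               else 0.
Proof.
have E0 : (0 : 'I_n.+2) = lshift n.+1 (0 : 'I_1) by apply: val_inj.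
have ES (k : 'I_n.+1) : lift 0 k = rshift 1 k by apply: val_inj.
rewrite /sysB; case: (unliftP 0 i) => [i'|] ->; case: (unliftP 0 j) => [j'|] ->.
- by rewrite !ES (@block_mxEdr _ 1 n.+1 1 n.+1).
- by rewrite ES E0 (@block_mxEdl _ 1 n.+1 1 n.+1) mxE.
- by rewrite ES E0 (@block_mxEur _ 1 n.+1 1 n.+1) mxE.
by rewrite E0 (@block_mxEul _ 1 n.+1 1 n.+1) mxE.
Qed.

Lemma sysDE (t : R) (i j : 'I_n.+2) :
  sysD n t i j = (if i == 0 then 1 else t) *+ (i == j).
Proof.
have E0 : (0 : 'I_n.+2) = lshift n.+1 (0 : 'I_1) by apply: val_inj.
have ES (k : 'I_n.+1) : lift 0 k = rshift 1 k by apply: val_inj.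
rewrite /sysD; case: (unliftP 0 i) => [i'|] ->; case: (unliftP 0 j) => [j'|] ->;
  rewrite ?eqxx ?[lift 0 _ == 0]eq_sym ?(negPf (neq_lift _ _))
    ?(inj_eq lift_inj).
- by rewrite !ES (@block_mxEdr _ 1 n.+1 1 n.+1) mxE.
- by rewrite ES E0 (@block_mxEdl _ 1 n.+1 1 n.+1) mxE.
- by rewrite ES E0 (@block_mxEur _ 1 n.+1 1 n.+1) mxE.
by rewrite E0 (@block_mxEul _ 1 n.+1 1 n.+1) mxE.
Qed.
End Entries.

(** * Signed permutation matrices and orthogonality *)

Section SignedPerm.
Variables (R : numDomainType) (n : nat) (P : 'M[R]_n).
Hypothesis hP : signed_perm_mx P.

Lemma signed_perm_row i j j' : P i j != 0 -> P i j' != 0 -> j = j'.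
Proof.
move=> Pj Pj'; have /mem_card1[x Ex] := hP.2.1 i.
have /esym := Ex j; have /esym := Ex j'.
by rewrite !inE Pj Pj' => /eqP-> /eqP->.
Qed.

Lemma signed_perm_col i i' j : P i j != 0 -> P i' j != 0 -> i = i'.
Proof.
move=> Pj Pj'; have /mem_card1[x Ex] := hP.2.2 j.
have /esym := Ex i; have /esym := Ex i'.
by rewrite !inE Pj Pj' => /eqP-> /eqP->.
Qed.

Lemma signed_perm_sqr i j : P i j != 0 -> P i j * P i j = 1.
Proof.
have := hP.1 i j; rewrite !inE => /or3P[]/eqP->; rewrite ?eqxx // => _.
  by rewrite mulrNN mulr1.
by rewrite mulr1.
Qed.

Lemma signed_perm_orthogonal : P *m P^T = 1%:M.
Proof.
apply/matrixP => i i'; rewrite !mxE.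
have /mem_card1[j Ej] := hP.2.1 i.
have Pj : P i j != 0 by have := Ej j; rewrite !inE eqxx.
rewrite (bigD1 j) //= big1 => [|k kj]; last first.
  by have := Ej k; rewrite !inE (negPf kj) => /negbFE/eqP->; rewrite mul0r.
rewrite addr0 mxE; case: eqP => [<-|ii']; first exact: signed_perm_sqr.
have [->|Pj'] := eqVneq (P i' j) 0; first by rewrite mulr0.
by case: ii'; apply: signed_perm_col Pj Pj'.
Qed.
End SignedPerm.

(** The first row is supported on the last column, where all other rows vanish; those rows carry the
    rows of [P]. *)
Lemma sysA_orthogonal (R : pzRingType) (n : nat) (s : R) (P : 'M[R]_n.+1) :
  s * s = 1 -> P *m P^T = 1%:M -> sysA s P *m (sysA s P)^T = 1%:M.
Proof.
move=> ss PP; apply/matrixP => i j; rewrite !mxE big_ord_recr /= !mxE.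
have Ew (k : 'I_n.+1) : widen_ord (leqnSn n.+1) k != ord_max.
  by rewrite -val_eqE /= ltn_eqF.
case: (unliftP 0 i) => [i'|] ->; case: (unliftP 0 j) => [j'|] ->.
- rewrite !sysASE ltnn mulr0 addr0 (inj_eq lift_inj).
  have /matrixP/(_ i' j') := PP; rewrite !mxE => <-.
  by apply: eq_bigr => k _; rewrite !mxE !sysASE /= ltn_ord inord_val.
- rewrite sysASE ltnn mul0r addr0 big1 // => k _.
  by rewrite !mxE sysA0E (negPf (Ew k)) mulr0.
- rewrite sysASE ltnn mulr0 addr0 big1 // => k _.
  by rewrite !mxE sysA0E (negPf (Ew k)) mul0r.
rewrite !sysA0E eqxx ss big1 ?add0r // => k _.
by rewrite !mxE sysA0E (negPf (Ew k)) mul0r.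
Qed.

(** * Symmetries of [Pstar] and their converse *)

Lemma PstarE (R : pzRingType) (n : nat) (s : R) (i j : 'I_n.+1) :
  Pstar n s i j = if (i + j == n)%N then
     s * (-1) ^+ (if (j.*2 <= n)%N then j : nat else (n - j).+1) else 0.
Proof.
rewrite mxE addSn addnS !eqSS; case: eqP => // _.
have -> : (2 * j.+1 <= n.+2)%N = (j.*2 <= n)%N by rewrite mul2n doubleS !ltnS.
by case: ifP => _; rewrite ?subn1 // subSS subSn // -ltnS.
Qed.

(** If i + j = n and i, j differ, exactly one of the two columns is in the left half, and the
    exponent of the other entry is larger by one. *)
Lemma Pstar_antisym (R : pzRingType) (n : nat) (s : R) (i j : 'I_n.+1) :
  i != j -> Pstar n s i j + Pstar n s j i = 0.
Proof.
move=> ij; rewrite !PstarE addnC; case: eqP => [ijn|]; last by rewrite addr0.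
have {}ij : i <> j :> nat by move/val_inj/eqP; rewrite (negPf ij).
case: ifP => lj; case: ifP => li; try lia.
  have -> : (n - i)%N = j by lia.
  by rewrite exprS mulN1r mulrN addrN.
have -> : (n - j)%N = i by lia.
by rewrite exprS mulN1r mulrN addNr.
Qed.

(** A nonzero diagonal entry needs n = 2i; then m is even, sigma_0 = (-1)^(i+1), and the entry is
    (-1)^(2i+1) = -1. Here the sign of sigma_0 for even m matters. *)
Lemma Pstar_diag_le0 (R : numDomainType) (n : nat) (s : R) (i : 'I_n.+1) :
  sigma0_ok n.+2 s -> Pstar n s i i <= 0.
Proof.
move=> [_ seven]; rewrite PstarE; case: eqP => // iin.
have -> : s = (-1) ^+ i.+1.
  by rewrite seven; [congr (_ ^+ _); lia | rewrite /= negbK; lia].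
have -> : (i.*2 <= n)%N by lia.
by rewrite -exprD addSn addnn exprS mulN1r -signr_odd odd_double oppr_le0 ler01.
Qed.

(** Inside [A] the rows of [P] sit one lower, so transposition pairs columns j and n + 1 - j of [P],
    whose exponents agree. *)
Lemma sysA_Pstar_sym (R : pzRingType) (n : nat) (s : R) :
  (sysA s (Pstar n s))^T = sysA s (Pstar n s).
Proof.
apply/matrixP => i j; rewrite mxE.
case: (ord0_or_lift _ i) => [|[i']] ->;
  case: (ord0_or_lift _ j) => [|[j']] -> //; last first.
- rewrite !sysASE /= /bump /= !add1n !ltnS.
  case: (ltnP i' n) => [li|li]; case: (ltnP j' n) => [lj|lj];
    rewrite ?PstarE ?inordK //.
  + rewrite !addnS [(j' + i')%N]addnC; case: eqP => // ijn.
    congr (_ * _ ^+ _); case: ifP; case: ifP; lia.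
  + by case: eqP => //; lia.
  by case: eqP => //; lia.
- rewrite sysA0E sysASE ltn0Sn PstarE inordK // addn0 subn0 double0 /= expr0
    mulr1.
  by rewrite -val_eqE /= /bump /= add1n eqSS.
rewrite sysA0E sysASE ltn0Sn PstarE inordK // addn0 subn0 double0 /= expr0
    mulr1.
by rewrite -val_eqE /= /bump /= add1n eqSS.
Qed.

(* Starting from the corner entry P n 0 = s, the symmetry of A and the
   antisymmetry of P alternately carry one antidiagonal entry to the next. *)
Lemma sym_antisym_Pstar (R : numDomainType) (n : nat) (s : R) (P : 'M[R]_n.+1) :
    s * s = 1 -> signed_perm_mx P ->
    (forall i j, i != j -> P i j + P j i = 0) ->
    (sysA s P)^T = sysA s P -> P = Pstar n s.
Proof.
move=> ss hP Panti /matrixP Asym.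
have s0 : s != 0.
  by apply: contra_eq_neq ss => ->; rewrite mul0r eq_sym oner_neq0.
have corner : P ord_max 0 = s.
  have := Asym 0 (lift 0 ord_max).
  rewrite mxE sysA0E sysASE -val_eqE /= eqxx => <-.
  by congr (P _ _); apply: val_inj; rewrite /= inordK.
(* Symmetry of [A] in the indices of [P]: (i, j) goes to (j - 1, i + 1). *)
have step (i j : 'I_n.+1) : (i < n)%N -> (0 < j)%N ->
    P i j = P (inord j.-1) (inord i.+1).
  move=> lin j0; have := Asym (lift 0 (inord j.-1)) (lift 0 i).
  rewrite mxE !sysASE /= /bump /= !add1n !ltnS lin inordK; last first.
    by have := ltn_ord j; lia.
  have -> : (j.-1 < n)%N by have := ltn_ord j; lia.
  rewrite prednK // => <-; congr (P _ _).
  by apply: val_inj; rewrite /= inordK.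
(* Induction along the left half: [step] sends (n-j-1, j+1) to (j, n-j), and antisymmetry sends that
   to (n-j, j) with a sign change. *)
have low : forall j : nat, (j.*2 <= n)%N ->
    P (inord (n - j)) (inord j) = s * (-1) ^+ j.
  elim=> [_|j IH hj].
    rewrite subn0 mulr1 -corner.
    by congr (P _ _); apply: val_inj; rewrite /= inordK.
  rewrite step ?inordK //; try lia.
  have -> : (n - j.+1).+1 = (n - j)%N by lia.
  rewrite /= exprS mulN1r mulrN -IH; last lia.
  apply/eqP; rewrite -addr_eq0; apply/eqP/Panti.
  by rewrite -val_eqE /= !inordK; lia.
have anti : forall i j : 'I_n.+1, (i + j)%N = n -> P i j = Pstar n s i j.
  move=> i j ijn; rewrite PstarE ijn eqxx; case: ifP => hj.
    by rewrite -low //; congr (P _ _); apply: val_inj; rewrite /= inordK; lia.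
  have := Panti i j; rewrite -val_eqE /= => /(_ _)/eqP.
  rewrite addr_eq0 => /(_ _)/eqP -> //; last lia.
  rewrite exprS mulN1r mulrN -low; last lia.
  by congr (- P _ _); apply: val_inj; rewrite /= inordK; lia.
apply/matrixP => i j; case: (eqVneq (i + j)%N n) => [/anti //|ijn].
(* The antidiagonal entry of row i is nonzero, hence the only nonzero one. *)
have ri : (i + rev_ord i = n)%N by rewrite /=; have := ltn_ord i; lia.
have Pr : P i (rev_ord i) != 0.
  by rewrite anti // PstarE ri eqxx mulf_neq0 // signr_eq0.
rewrite PstarE (negPf ijn); apply/eqP; apply: contraNT ijn => Pij.
by rewrite (signed_perm_row _ _ _ hP _ _ _ Pij Pr) ri.
Qed.

(** * Perturbation of eigenvalues and spectral consequences of stability *)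

Section Stability.
Variable R : rcfType.
Local Notation C := R[i].
Local Notation Re := complex.Re.
Local Notation Im := complex.Im.
Local Notation "x %:C" := (real_complex R x).
Local Notation mapC := (map_mx (real_complex R)).

(* A monic f of degree n whose roots all satisfy Re <= 0 has
   |f(z)| >= (Re z)^n when Re z > 0; this replaces continuity of roots. *)
Lemma eigenvalue_perturb (n : nat) (M N : 'M[C]_n) (z : C) :
    eigenvalue M z -> 0 < Re z ->
  exists2 e : R, 0 < e & exists2 w, eigenvalue (M + e%:C *: N) w & 0 < Re w.
Proof.
rewrite eigenvalueE => /eqP Mz; set r := Re z => r_gt0.
(* p(x) is the characteristic polynomial of M + xN at z; as p(0) = 0, |p(e)| is O(e). *)
pose p : {poly C} := \det (map_mx polyC (z%:M - M) - 'X *: map_mx polyC N).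
have pE x : p.[x] = \det (z%:M - (M + x *: N)).
  rewrite -[p.[x]]/(horner_eval x p) -det_map_mx; congr (\det _).
  apply/matrixP => i j; rewrite !mxE /= /horner_eval !hornerE.
  by rewrite opprD addrA [x * _]mulrC.
have : root p 0 by rewrite rootE pE scale0r addr0 Mz.
move=> /factor_theorem[q pq]; rewrite subr0 in pq.
have [ub qub] := poly_disk_bound q 1.
have ub_ge0 : 0 <= ub.
  by apply: le_trans (normr_ge0 q.[0]) (qub _ _); rewrite normr0 ler01.
have ubR : ub = (Re ub)%:C by rewrite RRe_real ?ger0_real.
set u := Re ub in ubR; have u_ge0 : 0 <= u by rewrite -ler0c -ubR.
have rn_gt0 : 0 < r ^+ n by rewrite exprn_gt0.
(* Chosen so that e <= 1, inside the disk where [q] is bounded by [u], and e u < r^n. *)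
pose e := r ^+ n / (r ^+ n + u + 1).
have den_gt0 : 0 < r ^+ n + u + 1 by rewrite !ltr_wpDr.
have e_gt0 : 0 < e by rewrite divr_gt0.
exists e => //.
have e_le1 : e <= 1 by rewrite ler_pdivrMr // mul1r -addrA lerDl addr_ge0.
have eu_lt : e * u < r ^+ n.
  by rewrite /e mulrAC ltr_pdivrMr // ltr_pM2l // -addrA ltr_pwDl // lerDl.
have [ws Ews] := closed_field_poly_normal (char_poly (M + e%:C *: N)).
rewrite (monicP (char_poly_monic _)) scale1r in Ews.
have sz : size ws = n.
  by have := size_char_poly (M + e%:C *: N); rewrite Ews size_prod_XsubC => -[].
have [/hasP[w ws_w w_gt0]|/hasPn allneg] := boolP (has (fun w => 0 < Re w) ws).
  by exists w => //; rewrite eigenvalue_root_char Ews root_prod_XsubC.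
have normp : `|p.[e%:C]| <= (e * u)%:C.
  have eC1 : `|e%:C| <= 1.
    by rewrite ger0_norm ?ler0c ?(ltW e_gt0) //; have := lecR e 1 => ->.
  have -> : (e * u)%:C = ub * e%:C by rewrite ubR -rmorphM mulrC.
  rewrite pq hornerM hornerX normrM ler_pM //; first exact: qub.
  by rewrite ger0_norm // ler0c ltW.
have pchar : p.[e%:C] = (char_poly (M + e%:C *: N)).[z].
  rewrite pE -[RHS]/(horner_eval z _) /char_poly -det_map_mx; congr (\det _).
  apply/matrixP => i j; rewrite !mxE /= /horner_eval !hornerE.
  by rewrite hornerMn hornerX.
(* Each root w gives |z - w| >= Re z - Re w >= r. *)
have : (r ^+ n)%:C <= `|p.[e%:C]|.
  rewrite pchar Ews horner_prod normr_prod -sz.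
  elim: ws allneg {Ews sz} => [|w ws IH] allneg; first by rewrite big_nil.
  rewrite big_cons exprS rmorphM /= ler_pM ?ler0c ?exprn_ge0 ?(ltW r_gt0) //.
    rewrite hornerXsubC (le_trans _ (normc_ge_Re _)) // lecR.
    have := allneg w (mem_head _ _); rewrite -leNgt => w_le0.
    have -> : Re (z - w) = r - Re w by rewrite /r; case: (z) (w) => ? ? [].
    by rewrite (le_trans _ (ler_norm _)) // lerDl oppr_ge0.
  by apply: IH => v wsv; apply: allneg; rewrite inE wsv orbT.
by move=> /le_trans/(_ normp); rewrite lecR leNgt eu_lt.
Qed.

Lemma mapC_trC (m n : nat) (M : 'M[R]_(m, n)) : (mapC M)^t* = mapC M^T.
Proof. by apply/matrixP => i j; rewrite !mxE; apply: conjc_real. Qed.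

Lemma orthogonal_normalmx (n : nat) (M : 'M[R]_n) :
  M *m M^T = 1%:M -> mapC M \is normalmx.
Proof.
move=> MM; apply/normalmxP.
by rewrite mapC_trC -!map_mxM MM (mulmx1C MM).
Qed.

Lemma orthogonal_real_spectrum_sym (n : nat) (M : 'M[R]_n) :
  M *m M^T = 1%:M -> (forall a, eigenvalue (mapC M) a -> Im a = 0) -> M^T = M.
Proof.
move=> /orthogonal_normalmx nM Im0.
have := @normalmx_real_spectrum _ _ _ nM; rewrite mapC_trC => H.
apply/matrixP => i j; have /matrixP/(_ i j) : mapC M^T = mapC M.
  by apply: H => -[x y] /Im0 /= ->; congr Complex; rewrite oppr0.
by rewrite !mxE => /complexI.
Qed.

Lemma orthogonal_dissipative (n : nat) (M : 'M[R]_n) :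
    M *m M^T = 1%:M -> (forall a, eigenvalue (mapC M) a -> Re a <= 0) ->
  forall y : 'rV[R]_n, (y *m (M + M^T) *m y^T) 0 0 <= 0.
Proof.
move=> /orthogonal_normalmx nM Re0 y.
have /(_ _ (mapC y)) := @normalmx_dissipative _ _ _ nM.
rewrite !mapC_trC -map_mxD -!map_mxM mxE => H.
rewrite -lecR; apply: H => a /Re0 a0.
rewrite [a + _]addcJ pmulr_rle0 ?ltr0n //.
by have := lecR (Re a) 0 => ->.
Qed.

(** When P i j is nonzero off the diagonal, P i i = P j j = 0, so the form at e_i + t e_j is linear
    in t and of constant sign, hence zero. *)
Lemma dissipative_signed_perm (n : nat) (P : 'M[R]_n) : signed_perm_mx P ->
    (forall y : 'rV[R]_n, (y *m (P + P^T) *m y^T) 0 0 <= 0) ->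
  forall i j, i != j -> P i j + P j i = 0.
Proof.
move=> hP neg.
have half i j : P i j != 0 -> i != j -> P i j + P j i = 0.
  move=> Pij ij.
  have Pii : P i i = 0.
    apply/eqP; apply: contraNT ij => Pii.
    by rewrite (signed_perm_row _ _ _ hP _ _ _ Pii Pij).
  have Pjj : P j j = 0.
    apply/eqP; apply: contraNT ij => Pjj.
    by rewrite (signed_perm_col _ _ _ hP _ _ _ Pjj Pij).
  have Q (t : R) : t * (P i j + P j i) <= 0.
    have := neg (delta_mx 0 i + t *: delta_mx 0 j).
    have -> : (delta_mx 0 i + t *: delta_mx 0 j)^T
              = delta_mx i 0 + t *: delta_mx j 0 :> 'cV[R]_n.
      by apply/colP => l; rewrite !mxE !eqxx !andbT.
    rewrite mulmxDl -scalemxAl -!rowE.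
    rewrite !mulmxDr -!scalemxAr -!colE !mxE Pii Pjj; nra.
  by apply/eqP; rewrite eq_le; have := Q 1; have := Q (-1); lra.
move=> i j ij; have [Pij|/half->//] := eqVneq (P i j) 0.
have [Pji|/half] := eqVneq (P j i) 0; first by rewrite Pij Pji addr0.
by rewrite addrC eq_sym => ->.
Qed.

Variables (n : nat) (s : R) (P : 'M[R]_n.+1).

Lemma stable_spectrum (k : R) (a : C) : stable s P ->
  eigenvalue (mapC (sysB P) - ('i%C * k%:C) *: mapC (sysA s P)) a -> Re a <= 0.
Proof.
move=> st; rewrite eigenvalueE => /eqP Da.
(* With tau = 1, [D] is the identity; omega = i a gives -i omega = a. *)
have -> : Re a = Im ('i%C * a) by rewrite mulrC ImiRe.
apply: (st 1 ltr01 k); rewrite -[RHS]Da; congr (\det _).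
have -> : sysD n 1 = 1%:M :> 'M[R]_n.+2 by rewrite /sysD -scalar_mx_block.
have -> : - ('i%C * ('i%C * a)) = a by rewrite mulrA -expr2 sqr_i mulN1r opprK.
by rewrite map_scalar_mx rmorph1 scalemx1 opprB addrA.
Qed.

Lemma stable_spectrum_P (a : C) : stable s P ->
  eigenvalue (mapC P) a -> Re a <= 0.
Proof.
move=> st ev; apply: (stable_spectrum 0 _ st).
rewrite rmorph0 mulr0 scale0r subr0; move: ev.
rewrite !eigenvalueE => /eqP Da; apply/eqP.
rewrite /sysB (map_block_mx _ (0 : 'M_1) 0 0 P) !map_mx0.
rewrite (scalar_mx_block 1 n.+1) (opp_block_mx (0 : 'M_1))
  (add_block_mx (a%:M : 'M_1)) !oppr0 !addr0.
by rewrite (@det_ublock _ 1 n.+1) Da mulr0.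
Qed.

(* The unstable mode has k = Im a / e with e small, so that k has the sign
   for which -ika points into Re > 0. *)
Lemma stable_spectrum_A (a : C) : stable s P ->
  eigenvalue (mapC (sysA s P)) a -> Im a = 0.
Proof.
move=> st ev; apply/eqP/negPn/negP => Ima.
set c := Im a in Ima.
have ev' := @eigenvalueZ _ _ _ _ (- ('i%C * c%:C)) ev.
have Rez : 0 < Re (- ('i%C * c%:C) * a).
  have -> : Re (- ('i%C * c%:C) * a) = c ^+ 2.
    by rewrite /c; case: (a) => x y /=; ring.
  by rewrite lt_neqAle sqr_ge0 eq_sym expf_eq0 /= Ima.
have [e e0 [w evw w0]] := @eigenvalue_perturb _ _ (mapC (sysB P)) _ ev' Rez.
have eC0 : e%:C != 0 by rewrite (inj_eq (@complexI R) e 0) gt_eqF.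
(* Division by e turns -icA + eB into B - i(c/e)A. *)
have := @eigenvalueZ _ _ _ _ (e^-1)%:C evw.
rewrite scalerDr !scalerA fmorphV mulVf // scale1r addrC mulrN scaleNr.
rewrite mulrCA -fmorphV -rmorphM => /(stable_spectrum _ _ st).
have -> : Re ((e^-1)%:C * w) = e^-1 * Re w by case: (w) => x y /=; ring.
by rewrite leNgt mulr_gt0 ?invr_gt0.
Qed.
End Stability.

(* Energy estimate: the hermitian part of the symbol is diagonal, and positive
   definite as soon as Im omega > 0. *)
Lemma Pstar_stable (R : rcfType) (n : nat) (s : R) :
  sigma0_ok n.+2 s -> stable s (Pstar n s).
Proof.
move=> hs t t0 k w; set A := sysA _ _; set B := sysB _; set D := sysD _ _.
set M := (X in \det X).
move=> /eqP/det0P[v v0 vM]; rewrite leNgt; apply/negP => w0.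
(* The diagonal of M + M^*: ikA is skew-hermitian, and [B] is antisymmetric off its diagonal. *)
pose g (i : 'I_n.+2) := 2 * (complex.Im w * D i i - B i i).
have Bdiag i : B i i <= 0.
  by rewrite /B sysBE; case: unliftP => // j _; apply: Pstar_diag_le0.
have Banti i j : i != j -> B i j = - B j i.
  move=> ij; rewrite /B !sysBE; apply/eqP; rewrite -addr_eq0; apply/eqP.
  move: ij; case: (unliftP 0 i) => [i'|] ->; case: (unliftP 0 j) => [j'|] -> ij;
    rewrite ?addr0 //.
  by apply: Pstar_antisym; apply: contraNneq ij => ->.
have Asym i j : A j i = A i j.
  by have /matrixP/(_ i j) := sysA_Pstar_sym R n s; rewrite mxE.
have Dpos i : 0 < D i i.
  by rewrite /D sysDE eqxx mulr1n; case: ifP.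
have Doff i j : i != j -> D i j = 0.
  by move=> ij; rewrite /D sysDE (negPf ij).
have gpos i : 0 < g i.
  by rewrite mulr_gt0 // subr_gt0 (le_lt_trans (Bdiag i)) // mulr_gt0.
have ME : M + M^t* = diag_mx (\row_i real_complex R (g i)).
  clearbody A B D; apply/matrixP => i j; rewrite !mxE.
  have [<-|ij] := eqVneq i j; rewrite ?mulr1n ?mulr0n.
    rewrite /g; case: (w) => x y; apply/eqP; rewrite eq_complex /=.
    by apply/andP; split; apply/eqP; ring.
  rewrite (Banti i j ij) Asym Doff // (Doff j i) 1?eq_sym //.
  case: (w) => x y; apply/eqP; rewrite eq_complex /=.
  by apply/andP; split; apply/eqP; ring.
have : (v *m (M + M^t*) *m v^t*) 0 0 = 0.
  rewrite mulmxDr vM add0r -mulmxA.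
  have -> : M^t* *m v^t* = (v *m M)^t* by rewrite trmx_mul map_mxM.
  by rewrite vM trmx0 map_mx0 mulmx0 mxE.
(* The sum of g_i |v_i|^2 vanishes with all g_i > 0, forcing v = 0. *)
rewrite ME mul_mx_diag mxE => /eqP; rewrite psumr_eq0; last first.
  move=> i _; rewrite !mxE mulrAC -normCK mulr_ge0 ?exprn_ge0 //.
  by rewrite ler0c ltW.
move=> /allP v00; move/eqP: v0; apply; apply/rowP => i.
have := v00 i; rewrite mem_index_enum => /(_ isT) /=.
rewrite !mxE mulrAC -normCK mulf_eq0 expf_eq0 /= normr_eq0.
by rewrite (inj_eq (@complexI R) (g i) 0) (gt_eqF (gpos i)) orbF => /eqP.
Qed.

(* m = n.+2 ranges over all integers m >= 2 *)
Theorem theorem1 (R : rcfType) (n : nat) (s : R)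
  (hs : sigma0_ok n.+2 s) (P : 'M[R]_n.+1) (hP : signed_perm_mx P) :
  stable s P <-> P = Pstar n s.
Proof.
split=> [st|->]; last exact: Pstar_stable.
have ss := sigma0_sqr _ _ _ hs; have PP := signed_perm_orthogonal _ _ _ hP.
apply: sym_antisym_Pstar => //.
  apply: dissipative_signed_perm hP _; apply: orthogonal_dissipative => // a.
  exact: stable_spectrum_P st.
apply: orthogonal_real_spectrum_sym; first exact: sysA_orthogonal.
by move=> a; apply: stable_spectrum_A.
Qed.
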